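(* Let $w:[0,+\infty)\to(0,+\infty)$ be a rapid weight function. Assume that $w$ is log-convex and $\mathcal{C}^2$-smooth. Let $\Phi_w(x)=\log w(e^x)$, $x\in\mathbb{R}$. (i) If $\liminf_{x\to+\infty}\Phi_w''(x)>0$, then $w$ is equivalent to a log-tropical weight function. (ii) If $\limsup_{x\to+\infty}\Phi_w''(x)=0$, then $w$ is not equivalent to any log-tropical weight function.
   Context: A weight function $w:[0,+\infty)\to(0,+\infty)$ is a non-decreasing, continuous and unbounded function. It is rapid if $\lim_{t\to\infty}t^{-k}w(t)=\infty$ for all $k\in\mathbb{N}$. It is log-convex if $\log w(t)$ is a convex function of $\log t$, $0<t<+\infty$, i.e. if $\Phi_w$ is convex on $\mathbb{R}$. Two functions $u,v:[0,+\infty)\to(0,+\infty)$ are equivalent ($u\asymp v$) if there are constants $C_1,C_2>0$ with $C_1u(t)\le v(t)\le C_2u(t)$ for all $t\ge 0$. A tropical power series on $\mathbb{R}$ is a function of the form $\Psi(x)=\sup_{j\in E}(b_j+jx)$, $x\in\mathbb{R}$, where $E\subset\mathbb{Z}_+=\{0,1,2,\dots\}$ is an arbitrary subset, $b_j\in\mathbb{R}$ for $j\in E$, and the supremum is finite for all $x\in\mathbb{R}$. A weight function $v:[0,+\infty)\to(0,+\infty)$ is log-tropical if $\Phi_v(x)=\log v(e^x)$, $x\in\mathbb{R}$, is a tropical power series. *)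

(* Defs.v *)
From mathcomp Require Import all_boot all_order all_algebra.
From mathcomp Require Import all_classical all_reals all_analysis.

Set Implicit Arguments.
Unset Strict Implicit.
Unset Printing Implicit Defensive.

Import Order.TTheory GRing.Theory Num.Theory.
Import numFieldNormedType.Exports.

Local Open Scope classical_set_scope.
Local Open Scope ring_scope.

(* A function [0, +oo) -> (0, +oo) is represented by a total function R -> R
   whose values on negative reals are unconstrained: every notion below only
   depends on the restriction to `[0, +oo[. *)

Definition weight_function (R : realType) (w : R -> R) : Prop :=
  [/\ forall t, 0 <= t -> 0 < w t,
      {in `[0, +oo[ &, {homo w : s t / s <= t}},
      {within `[0, +oo[, continuous w} &
      ~ has_ubound (w @` `[0, +oo[)].

Definition rapid (R : realType) (w : R -> R) : Prop :=
  forall k : nat, t ^- k * w t @[t --> +oo] --> +oo.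

Definition Phi (R : realType) (w : R -> R) : R -> R := fun x => ln (w (expR x)).

Definition log_convex (R : realType) (w : R -> R) : Prop :=
  convex_function (setT : set R^o) (Phi w).

(* At an endpoint of an interval D the punctured neighbourhood filter within D
   is one-sided, so the derivative there is the one-sided derivative. *)
Definition derivative_on (R : realType) (D : set R) (f g : R -> R) : Prop :=
  forall t, D t -> (f s - f t) / (s - t) @[s --> within D t^'] --> g t.

Definition C2_on (R : realType) (D : set R) (f : R -> R) : Prop :=
  exists f1 f2 : R -> R,
    [/\ derivative_on D f f1, derivative_on D f1 f2 &
        {within D, continuous f2}].

Definition equivalent (R : realType) (u v : R -> R) : Prop :=
  exists C1 C2 : R, [/\ 0 < C1, 0 < C2 &
    forall t, 0 <= t -> C1 * u t <= v t <= C2 * u t].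

(* Since Psi x is real, the equation forces the supremum to be finite, and in
   particular E to be nonempty (the supremum of set0 is -oo). *)
Definition tropical_power_series (R : realType) (Psi : R -> R) : Prop :=
  exists (E : set nat) (b : nat -> R),
    forall x, ereal_sup [set (b j + j%:R * x)%:E | j in E] = (Psi x)%:E.

Definition log_tropical_weight (R : realType) (v : R -> R) : Prop :=
  weight_function v /\ tropical_power_series (Phi v).

(* Main.v *)
Require Import Defs.
From mathcomp Require Import all_boot all_order all_algebra.
From mathcomp Require Import all_classical all_reals all_analysis.
From mathcomp Require Import ring lra.

Set Implicit Arguments.
Unset Strict Implicit.
Unset Printing Implicit Defensive.

Import Order.TTheory GRing.Theory Num.Theory.
Import numFieldNormedType.Exports.

Local Open Scope classical_set_scope.
Local Open Scope ring_scope.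

(** Write P for Phi w, a convex function with P'' defined everywhere.

    (i) Replace w by the largest function of the form sup_j c_j t^j with c_j >= 0
    lying below it: [power_minorant w]. In the logarithmic variable x = ln t this
    is the Legendre biconjugate of P with slopes restricted to the natural
    numbers, so it loses something against P only because the tangent slope P'(x) must be
    rounded to an integer j <= P'(x) < j + 1. If P'' >= a > 0 near +oo, then P'
    drops by 1 over a distance 1/a, so the line of slope j through (x, P x)
    overshoots P only on [x - 1/a, x], where it does so by at most 1/a
    ([integral_slope_support]). Lowering it by 1/a gives a monomial below w
    which at t = e^x is worth e^(-1/a) w t. On the remaining bounded range of t
    the constant monomial is enough ([weight_le_power_minorant]).

    (ii) Let Psi be a tropical power series with |Psi - P| <= C. As w is rapid, P'
    is unbounded, and if moreover P'' tends to 0 there are arbitrarily long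
    intervals [x - L, x + L] on which P' stays in [j + 1/4, j + 3/4] for some
    integer j ([slope_between_integers]). An affine term of Psi that is almost
    optimal at x has slope either at most j, or at least j + 1; going to x - L or
    to x + L respectively, it gains at least L / 4 over P
    ([affine_minorant_gap]), which is absurd once L / 4 > 2 C + 1
    ([tropical_not_close]). *)

(** * Derivatives and convexity *)

Lemma derivative_on_is_derive (R : realType) (D : set R) (f g : R -> R) (t : R) :
  nbhs t D -> derivative_on D f g -> is_derive t 1 f (g t).
Proof.
move=> Dt /(_ t (nbhs_singleton Dt)) fg.
suff cfg : (fun h => h^-1 *: ((f \o shift t) (h *: 1) - f t)) @ 0^' --> g t.
  by apply: DeriveDef; [apply/cvg_ex; exists (g t) | exact: cvg_lim].
(* The change of variable s = h + t between the two difference quotients. *)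
have shiftD : h + t @[h --> (0 : R)^'] --> within D t^'.
  move=> A /= tA.
  have st : h + t @[h --> (0 : R)] --> t.
    by rewrite -[X in _ --> X]add0r; apply: cvgD; [exact: cvg_id | exact: cvg_cst].
  have near0 := st _ (@filterI _ _ (nbhs_filter t) _ _ Dt tA).
  change (nbhs (0 : R) [set h | h != 0 -> A (h + t)]).
  apply: (@filterS _ _ (nbhs_filter (0 : R)) _ _ _ near0) => h [Dh Ah] h0.
  by apply: Ah => //; rewrite -subr_eq0 addrK.
have -> : (fun h => h^-1 *: ((f \o shift t) (h *: 1) - f t)) =
    (fun s => (f s - f t) / (s - t)) \o (fun h => h + t).
  by apply/funext => h /=; rewrite addrK [h *: 1]mulr1 mulrC.
exact: cvg_comp shiftD fg.
Qed.

(** A convex function lies above its tangents: by convexity the difference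
    quotient in the direction y - x is at most f y - f x for steps in ]0, 1[, and
    it tends to the derivative as the step decreases to 0. *)
Lemma convex_tangent_le (R : realType) (f : R -> R) (x y d : R) :
  convex_function (setT : set R^o) f -> is_derive x 1 f d ->
  f x + d * (y - x) <= f y.
Proof.
move=> cf [df fd].
have dif : differentiable f x by apply/derivable1_diffP.
have dq : derivable f x (y - x) by exact: diff_derivable.
have dqE : 'D_(y - x) f x = d * (y - x).
  rewrite -fd !deriveE// -{1}[y - x]mulr1 -[_ * 1]/((y - x) *: 1) linearZ.
  by rewrite [RHS]mulrC.
rewrite -lerBrDl -dqE.
apply: (cvgr_to_le (cvg_dnbhs_at_right dq)).
near=> h.
have h0 : 0 < h by near: h; exact: nbhs_right_gt.
have h1 : h < 1 by near: h; exact: nbhs_right_lt.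
have h01 : Itv.spec (@Itv.num_sem R) (Itv.Real `[0%Z, 1%Z]) h.
  by apply/and3P; split => //=; rewrite ?in_itv/= ?ltW ?num_real.
have fh : f (h * y + (1 - h) * x) <= h * f y + (1 - h) * f x.
  exact: (cf (Itv.mk h01) y x (mem_set I) (mem_set I)).
rewrite /GRing.scale/= ler_pdivrMl// lerBlDr.
rewrite (_ : h * (y - x) + x = h * y + (1 - h) * x); last by ring.
by rewrite (_ : h * (f y - f x) + f x = h * f y + (1 - h) * f x); last by ring.
Unshelve. all: by end_near. Qed.

(** The exponential only takes interior values of [0, +oo[, so that the
    one-sided derivative of w at 0 does not interfere. *)
Lemma is_derive_Phi (R : realType) (w : R -> R) (x : R) :
  weight_function w -> C2_on `[0, +oo[ w ->
  is_derive x 1 (Phi w) ((Phi w)^`()%classic x) /\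
  is_derive x 1 (Phi w)^`()%classic ((Phi w)^`(2)%classic x).
Proof.
move=> [w0 _ _ _] [w1 [w2 [dw dw1 _]]].
have nbhs0 y : nbhs (expR y) (`[0, +oo[%classic : set R).
  near=> s; rewrite /= in_itv/= andbT ltW//.
  by near: s; apply: lt_nbhsr; exact: expR_gt0.
have we0 y : 0 < w (expR y) by apply: w0; exact: expR_ge0.
have dexp (f g : R -> R) (y : R) : derivative_on `[0, +oo[ f g ->
    is_derive y (1 : R) (f \o expR) (g (expR y) * expR y).
  by move=> /(derivative_on_is_derive (nbhs0 y)) df; exact: is_derive1_comp.
have dP (y : R) : is_derive y (1 : R) (Phi w) ((w (expR y))^-1 * (w1 (expR y) * expR y)).
  have dln := is_derive1_ln (we0 y); have dwe := dexp _ _ y dw.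
  exact: (@is_derive1_comp _ (@ln R) (w \o expR) y _ _ dln dwe).
have PE : (Phi w)^`()%classic = fun y => (w (expR y))^-1 * (w1 (expR y) * expR y).
  by apply/funext => y; rewrite derive1E; case: (dP y).
have dP1 (y : R) : derivable (Phi w)^`()%classic y 1.
  have [dwy _] := dexp _ _ y dw; have [dw1y _] := dexp _ _ y dw1.
  have dinv : derivable (fun z => ((w \o expR) z)^-1) y 1.
    by apply: (@derivableV _ _ (w \o expR)) dwy; exact: lt0r_neq0 (we0 y).
  rewrite PE.
  exact: (derivableM dinv (derivableM dw1y (@derivable_expR R y))).
split; first by have [d _] := dP x; apply: (DeriveDef d); rewrite derive1E.
by apply: (DeriveDef (dP1 x)); rewrite derive1nS derive1n1 derive1E.
Unshelve. all: by end_near. Qed.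

Lemma limf_einf_pinfty_gt0 (R : realType) (f : R -> R) :
  (0 < limf_einf (EFin \o f) (pinfty_nbhs R))%E ->
  exists a A : R, 0 < a /\ forall x, A < x -> a <= f x.
Proof.
rewrite limf_einfE => /ereal_sup_gt[_ [V [A [_ AV]] <-]] inf0.
have finf x : A < x -> (ereal_inf [set (EFin \o f) y | y in V] <= (f x)%:E)%E.
  by move=> Ax; apply: ereal_inf_lbound; exists x => //; exact: AV.
move: inf0 finf; case: (ereal_inf _) => [a|_ le_f|//].
- by rewrite lte_fin => a0 le_f; exists a, A; split=> // x /le_f; rewrite lee_fin.
- by have := le_f (A + 1); rewrite ltrDl ltr01 => /(_ isT).
Qed.

Lemma limf_esup_pinfty_lt (R : realType) (f : R -> R) (e : R) :
  (limf_esup (EFin \o f) (pinfty_nbhs R) < e%:E)%E ->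
  exists A : R, forall x, A < x -> f x <= e.
Proof.
rewrite limf_esupE => /ereal_inf_lt[_ [V [A [_ AV]] <-]] supe.
exists A => x Ax; rewrite -lee_fin; apply: le_trans (ltW supe).
by apply: ereal_sup_ubound; exists x => //; exact: AV.
Qed.

(** * The largest power series below a weight *)

(** The inequality is required at t = 0 too, so that the coefficient of degree 0
    is at most w 0, and the resulting power series lies below w up to 0. *)
Definition power_coefs (R : realType) (w : R -> R) (j : nat) : set R :=
  [set c | 0 <= c /\ forall t, 0 <= t -> c * t ^+ j <= w t].

Definition power_coef (R : realType) (w : R -> R) (j : nat) : R :=
  sup (power_coefs w j).

(** In the variable x = ln t this is the supremum over the natural numbers j
    of the affine functions of slope j below Phi w. *)
Definition power_minorant (R : realType) (w : R -> R) (t : R) : R :=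
  sup (range (fun j => power_coef w j * t ^+ j)).

(** An upper bound on the increments of t^n that is linear in t - s and has no
    factor depending on n besides u^n: multiplied by the n-th coefficient, the
    right-hand side is controlled by the power series at u. *)
Lemma exprB_le (R : realDomainType) (s t u : R) (n : nat) : 0 <= s -> s <= t -> t + 1 <= u ->
  t ^+ n - s ^+ n <= (t - s) * u ^+ n.
Proof.
move=> s0 st tu; have t0 := le_trans s0 st.
elim: n => [|n IH]; first by rewrite !expr0 subrr mulr1 subr_ge0.
have su : s ^+ n <= u ^+ n by apply: lerXn2r; rewrite ?nnegrE; lra.
have un0 : 0 <= u ^+ n by apply: exprn_ge0; lra.
rewrite (_ : t ^+ n.+1 - s ^+ n.+1 = t * (t ^+ n - s ^+ n) + (t - s) * s ^+ n).
  rewrite exprS; apply: (@le_trans _ _ (t * ((t - s) * u ^+ n) + (t - s) * u ^+ n)).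
    by rewrite lerD// ler_wpM2l// subr_ge0.
  rewrite (_ : _ + _ = (t - s) * ((t + 1) * u ^+ n)); last by ring.
  by rewrite ler_wpM2l ?subr_ge0// ler_wpM2r.
by rewrite !exprS; ring.
Qed.

Section PowerMinorant.
Context {R : realType}.
Context (w : R -> R) (w_gt0 : forall t, 0 <= t -> 0 < w t).

Local Notation c := (power_coef w).
Local Notation v := (power_minorant w).

Let coefs_ub j : has_ubound (power_coefs w j).
Proof.
exists (w 1) => d [_ /(_ 1 ler01)]; by rewrite expr1n mulr1.
Qed.

Let coefs0 j : power_coefs w j 0.
Proof. by split=> // t t0; rewrite mul0r ltW// w_gt0. Qed.

Lemma le_power_coef j d :
  0 <= d -> (forall t, 0 <= t -> d * t ^+ j <= w t) -> d <= c j.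
Proof. by move=> d0 dw; apply: ub_le_sup. Qed.

Lemma power_coef_ge0 j : 0 <= c j.
Proof. by apply: ub_le_sup. Qed.

Lemma power_coef_le j t : 0 <= t -> c j * t ^+ j <= w t.
Proof.
move=> t0; have [tj0|tj0] := eqVneq (t ^+ j) 0.
  by rewrite tj0 mulr0 ltW// w_gt0.
have tj_gt0 : 0 < t ^+ j by rewrite lt_neqAle eq_sym tj0 exprn_ge0.
rewrite -ler_pdivlMr//; apply: ge_sup; first by exists 0; exact: coefs0.
by move=> d [_ /(_ t t0)]; rewrite ler_pdivlMr.
Qed.

Lemma power_minorant_ge j t : 0 <= t -> c j * t ^+ j <= v t.
Proof.
move=> t0; apply: ub_le_sup; last by exists j.
by exists (w t) => _ [k _ <-]; exact: power_coef_le.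
Qed.

Lemma power_minorant_le t M : (forall j, c j * t ^+ j <= M) -> v t <= M.
Proof.
by move=> cM; apply: ge_sup => [|_ [j _ <-]//]; exists (c 0 * t ^+ 0), 0%N.
Qed.

Lemma power_minorant_le_weight t : 0 <= t -> v t <= w t.
Proof. by move=> t0; apply: power_minorant_le => j; exact: power_coef_le. Qed.

Lemma power_minorant_homo s t : 0 <= s -> s <= t -> v s <= v t.
Proof.
move=> s0 st; apply: power_minorant_le => j.
apply: le_trans (power_minorant_ge j (le_trans s0 st)).
by rewrite ler_wpM2l ?power_coef_ge0// lerXn2r// nnegrE// (le_trans s0).
Qed.

(** A convexity estimate: on [s, t] the slope of the power series is at most
    its slope over [t, u], which has length at least 1. *)
Lemma power_minorant_lipschitz s t u : 0 <= s -> s <= t -> t + 1 <= u ->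
  v t - v s <= (t - s) * v u.
Proof.
move=> s0 st tu; rewrite lerBlDl; apply: power_minorant_le => j.
have := ler_wpM2l (power_coef_ge0 j) (exprB_le j s0 st tu).
have := power_minorant_ge j s0.
have u0 : 0 <= u by lra.
have ts0 : 0 <= t - s by lra.
have := ler_wpM2l ts0 (power_minorant_ge j u0).
by rewrite mulrBr [(t - s) * (c j * _)]mulrCA; lra.
Qed.

Lemma power_minorant_continuous : {within `[0, +oo[, continuous v}.
Proof.
apply/subspace_continuousP => x; rewrite /= in_itv/= andbT => x0.
have v0 : 0 <= v (x + 2).
  apply: le_trans (power_minorant_ge 0 _); last lra.
  by rewrite mulr_ge0 ?power_coef_ge0 ?exprn_ge0//; lra.
apply/cvgrPdist_le => e e0; rewrite near_withinE.
(* The + 1 makes the Lipschitz constant on [0, x + 1] positive. *)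
have K0 : 0 < v (x + 2) + 1 by lra.
near=> t => /=; rewrite in_itv/= andbT => t0.
have xt1 : `|x - t| <= 1.
  by near: t; apply: cvgr_dist_le => //; exact: cvg_id.
have xte : `|x - t| <= e / (v (x + 2) + 1).
  by near: t; apply: cvgr_dist_le; [exact: cvg_id | exact: divr_gt0].
have : `|x - t| * (v (x + 2) + 1) <= e by rewrite -ler_pdivlMr.
apply: le_trans; apply: (@le_trans _ _ (`|x - t| * v (x + 2))); last first.
  by rewrite ler_wpM2l// lerDl.
have [xt|/ltW tx] := leP x t.
  rewrite distrC [`|x - t|]distrC !ger0_norm ?subr_ge0 ?power_minorant_homo//.
  apply: power_minorant_lipschitz => //.
  by move: xt1; rewrite ler_norml; lra.
rewrite !ger0_norm ?subr_ge0 ?power_minorant_homo//.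
by apply: power_minorant_lipschitz => //; lra.
Unshelve. all: by end_near. Qed.

(** The constant w 0 is one of the admissible monomials, of degree 0. *)
Lemma power_minorant_ge_at0 t :
  (forall s, 0 <= s -> w 0 <= w s) -> 0 <= t -> w 0 <= v t.
Proof.
move=> w0 t0; apply: le_trans (power_minorant_ge 0 t0); rewrite expr0 mulr1.
apply: le_power_coef; first by rewrite ltW// w_gt0.
by move=> s s0; rewrite expr0 mulr1 w0.
Qed.

(** Vanishing coefficients have no logarithm, and are left out of the index set;
    they contribute 0 to a positive supremum. *)
Lemma power_minorant_tropical :
  (forall t, 0 <= t -> 0 < v t) -> tropical_power_series (Phi v).
Proof.
move=> v0; exists [set j | 0 < c j], (fun j => ln (c j)) => x.
have vx0 : 0 < v (expR x) by apply: v0; exact: expR_ge0.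
have lnE j : 0 < c j -> ln (c j) + j%:R * x = ln (c j * expR x ^+ j).
  move=> cj0; rewrite lnM ?posrE ?exprn_gt0 ?expR_gt0// lnXn ?expR_gt0//.
  by rewrite expRK mulr_natl.
have ub j : 0 < c j -> ln (c j) + j%:R * x <= Phi v x.
  move=> cj0; rewrite lnE// ler_ln ?posrE ?mulr_gt0 ?exprn_gt0 ?expR_gt0//.
  by apply: power_minorant_ge; exact: expR_ge0.
apply/eqP; rewrite eq_le; apply/andP; split.
  by apply: ge_ereal_sup => _ [j /= cj0 <-]; rewrite lee_fin ub.
set S := ereal_sup _.
have leS j : 0 < c j -> ((ln (c j) + j%:R * x)%:E <= S)%E.
  by move=> cj0; apply: ereal_sup_ubound; exists j.
have [j0 cj0] : exists j, 0 < c j.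
  apply/not_existsP => cn; move: vx0; rewrite ltNge => /negP; apply.
  apply: power_minorant_le => j; have /negP := cn j; rewrite -leNgt => cj.
  by rewrite mulr_le0_ge0 ?exprn_ge0 ?expR_ge0.
move: leS; case: S => [M|_|/(_ _ cj0)//]; last by rewrite leey.
move=> leM; rewrite lee_fin -[M]expRK ler_ln ?posrE ?expR_gt0//.
apply: power_minorant_le => j.
have := power_coef_ge0 j; rewrite le_eqVlt => /predU1P[<-|cj].
  by rewrite mul0r expR_ge0.
have := leM j cj; rewrite lee_fin lnE// -[X in _ -> X <= _]lnK.
  by rewrite ler_expR.
by rewrite posrE mulr_gt0 ?exprn_gt0 ?expR_gt0.
Qed.

End PowerMinorant.

(** The bound by K also gives unboundedness of the minorant, hence that it is a
    weight function. *)
Lemma power_minorant_equivalent (R : realType) (w : R -> R) (K : R) :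
  weight_function w -> 0 < K ->
  (forall t, 0 <= t -> w t <= K * power_minorant w t) ->
  log_tropical_weight (power_minorant w) /\ equivalent w (power_minorant w).
Proof.
move=> [w0 wh wc wub] K0 wK.
have v0 t : 0 <= t -> 0 < power_minorant w t.
  by move=> t0; rewrite -(pmulr_rgt0 _ K0) (lt_le_trans (w0 t t0))// wK.
split; [split; [split|]|] => //.
- move=> s t; rewrite !in_itv/= !andbT => s0 t0 st.
  exact: power_minorant_homo.
- exact: power_minorant_continuous.
- case=> M vM; apply: wub; exists (K * M) => _ [t /= t0 <-].
  have t0' : 0 <= t by move: t0; rewrite in_itv/= andbT.
  apply: le_trans (wK t t0') _; rewrite ler_wpM2l ?(ltW K0)//.
  by apply: vM; exists t.
- exact: power_minorant_tropical.
- exists K^-1, 1; split => // [|t t0]; first by rewrite invr_gt0.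
  by rewrite mul1r power_minorant_le_weight// andbT ler_pdivrMl ?wK.
Qed.

(** * Convex functions and affine functions of integral slope *)

Section ConvexSlope.
Context {R : realType}.
Context (P P1 P2 : R -> R).
Context (P_convex : convex_function (setT : set R^o) P).
Context (dP : forall x : R, is_derive x (1 : R) P (P1 x)).
Context (dP1 : forall x : R, is_derive x (1 : R) P1 (P2 x)).

Lemma tangent_le x y : P x + P1 x * (y - x) <= P y.
Proof. exact: convex_tangent_le. Qed.

Lemma slope_continuous (D : set R) : {within D, continuous P1}.
Proof.
apply: continuous_subspaceT => x.
by apply/differentiable_continuous/derivable1_diffP; case: (dP1 x).
Qed.

Lemma slope_MVT x y : x <= y ->
  exists2 z, x <= z <= y & P1 y - P1 x = P2 z * (y - x).
Proof.
move=> xy.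
have [z] := MVT_segment xy (fun z _ => dP1 z) (@slope_continuous _).
by rewrite in_itv/=; exists z.
Qed.

Lemma slope_ge0 x : {homo P : y z / y <= z} -> 0 <= P1 x.
Proof.
move=> Ph; have := tangent_le x (x - 1); have := Ph (x - 1) x.
by rewrite gerBl ler01 => /(_ isT); lra.
Qed.

(** The rounded slope is j = floor (P1 x). To the right of x the tangent at x,
    which is steeper, already lies above the line of slope j. Since P2 >= a, the
    slope at z = x - 1/a is at most P1 x - 1 < j, so to the left of z the tangent
    at z descends more slowly than that line; between z and x the line exceeds
    the tangent at x by at most 1 * (x - z) = 1/a.
    Positivity of j also comes from the drop of the slope by 1, as P1 z >= 0;
    it spares a comparison with P at -oo, that is, with w at 0. *)
Lemma integral_slope_support (a A x : R) :
  {homo P : y z / y <= z} -> 0 < a -> (forall y, A < y -> a <= P2 y) ->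
  A + a^-1 < x ->
  exists2 j : nat, (0 < j)%N & forall y, P x + j%:R * (y - x) - a^-1 <= P y.
Proof.
move=> Ph a0 aP2 Ax.
have ia0 : 0 < a^-1 by rewrite invr_gt0.
have aia : a * a^-1 = 1 by rewrite divff// gt_eqF.
set z := x - a^-1; have Az : A < z by rewrite /z; lra.
have zx : z <= x by rewrite /z; lra.
have slopez : P1 z + 1 <= P1 x.
  have [y /andP[zy _] P1E] := slope_MVT zx.
  have := aP2 _ (lt_le_trans Az zy).
  rewrite -(ler_pM2r ia0) aia; have : x - z = a^-1 by rewrite /z; ring.
  by move=> xz; rewrite xz in P1E; lra.
have P1z0 := slope_ge0 z Ph.
have P1x0 := slope_ge0 x Ph.
have /andP[jP1 P1j] := truncn_itv P1x0.
set j := Num.truncn (P1 x) in jP1 P1j *.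
rewrite -natr1 in P1j.
exists j => [|y].
  rewrite lt0n; apply/eqP => j0; move: P1j; rewrite j0; lra.
have [xy|yx] := leP x y.
  have := tangent_le x y; have : 0 <= (P1 x - j%:R) * (y - x).
    by rewrite mulr_ge0 ?subr_ge0.
  by lra.
have [zy|yz] := leP z y.
  have := tangent_le x y; have : (P1 x - j%:R) * (x - y) <= 1 * (x - y).
    by rewrite ler_wpM2r; lra.
  have : x - y <= a^-1 by rewrite /z in zy; lra.
  lra.
have tz := tangent_le z y; have tx := tangent_le x z.
have : 0 <= (j%:R - P1 z) * (z - y) by rewrite mulr_ge0; lra.
have : (P1 x - j%:R) * (x - z) <= 1 * (x - z) by rewrite ler_wpM2r; lra.
have : x - z = a^-1 by rewrite /z; ring.
lra.
Qed.

(** P1 is continuous and unbounded, so it takes a half-integral value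
    j + 1/2 at some x far to the right, and by the mean value theorem it varies
    by at most 1/4 within distance L of x. *)
Lemma slope_between_integers (M L : R) : 0 <= L ->
  (forall k X : R, exists2 x, X <= x & k <= P1 x) ->
  (forall x, M < x -> L * P2 x <= 4^-1) ->
  exists x (j : nat), (P1 (x + L) <= j%:R + 3 / 4) /\ (j%:R + 1 / 4 <= P1 (x - L)).
Proof.
move=> L0 P1y LP2.
(* The whole interval [x - L, x + L] has to stay beyond M for x >= X. *)
pose X := M + 1 + L.
have [j _ P1X] : exists2 j : nat, True & P1 X <= j%:R.
  exists (Num.truncn (P1 X)).+1 => //.
  by apply/ltW; exact: truncnS_gt.
have [Y XY P1Y] := P1y (j%:R + 1) X.
have [|x] := @IVT R P1 X Y (j%:R + 1 / 2) XY (@slope_continuous _).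
  by rewrite ge_min le_max; apply/andP; split; apply/orP; [left|right]; lra.
rewrite in_itv/= => /andP[Xx xY] P1x; exists x, j.
have xL : x <= x + L by lra.
have Lx : x - L <= x by lra.
have [y1 /andP[xy1 _] P1E1] := slope_MVT xL.
have [y2 /andP[xy2 _] P1E2] := slope_MVT Lx.
have := LP2 y1; have := LP2 y2.
rewrite /X in Xx.
have -> : M < y1 by lra.
have -> : M < y2 by lra.
move=> /(_ isT) Ly2 /(_ isT) Ly1.
have e1 : x + L - x = L by ring.
have e2 : x - (x - L) = L by ring.
rewrite e1 [P2 _ * _]mulrC in P1E1; rewrite e2 [P2 _ * _]mulrC in P1E2.
by split; lra.
Qed.

(** An integral slope i differs by at least 1/4 from all slopes of P on
    [x - L, x + L]; the end y is x - L if i <= j, and x + L if i >= j + 1. *)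
Lemma affine_minorant_gap (L x b : R) (i j : nat) :
  0 <= L -> P1 (x + L) <= j%:R + 3 / 4 -> j%:R + 1 / 4 <= P1 (x - L) ->
  exists y, b + i%:R * x - P x + L / 4 <= b + i%:R * y - P y.
Proof.
move=> L0 hr hl.
have [ij|ji] := leqP i j.
  exists (x - L); have := tangent_le (x - L) x.
  have : 0 <= (P1 (x - L) - (j%:R + 1 / 4)) * L by rewrite mulr_ge0 ?subr_ge0.
  have : 0 <= (j%:R - i%:R) * L by rewrite mulr_ge0 ?subr_ge0 ?ler_nat.
  lra.
exists (x + L); have := tangent_le (x + L) x.
have : 0 <= (j%:R + 3 / 4 - P1 (x + L)) * L by rewrite mulr_ge0 ?subr_ge0.
have : 0 <= (i%:R - (j%:R + 1)) * L by rewrite mulr_ge0 ?subr_ge0 ?natr1 ?ler_nat.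
lra.
Qed.

Lemma tropical_not_close (C : R) :
  (forall k X : R, exists2 x, X <= x & k <= P1 x) ->
  (forall e, 0 < e -> exists M, forall x, M < x -> P2 x <= e) ->
  forall Psi, tropical_power_series Psi -> ~ (forall x, `|Psi x - P x| <= C).
Proof.
move=> P1y P2e Psi [E [b PsiE]] PsiP.
have C0 : 0 <= C by exact: le_trans (PsiP 0).
(* A term of Psi within 1 of the supremum at x starts at P x - C - 1 or above
   and may not exceed P + C, so it can gain at most 2 C + 1 over P. *)
pose L := 4 * (2 * C + 1) + 1.
have L0 : 0 < L by rewrite /L; lra.
have [M MP2] := P2e (4 * L)^-1 ltac:(rewrite invr_gt0; lra).
have [x Mx|x [j [hr hl]]] := slope_between_integers (ltW L0) P1y (M := M).
  have := MP2 _ Mx; rewrite -(ler_pM2l L0) => /le_trans; apply.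
  by rewrite invfM mulrCA divff ?gt_eqF// mulr1.
have : ((Psi x - 1)%:E < ereal_sup [set (b j + j%:R * x)%:E | j in E])%E.
  by rewrite PsiE lte_fin; lra.
case/ereal_sup_gt => _ [i Ei <-]; rewrite lte_fin => bix.
have [y] := affine_minorant_gap (b i) i (ltW L0) hr hl.
have : b i + i%:R * y <= Psi y.
  by rewrite -lee_fin -PsiE; apply: ereal_sup_ubound; exists i.
have := PsiP x; have := PsiP y; rewrite !ler_norml /L; lra.
Qed.

End ConvexSlope.

(** * Weights in logarithmic coordinates *)

Lemma Phi_homo (R : realType) (w : R -> R) :
  weight_function w -> {homo Phi w : x y / x <= y}.
Proof.
move=> [w0 wh _ _] x y xy.
rewrite /Phi ler_ln ?posrE ?w0 ?expR_ge0//.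
by apply: wh; rewrite ?in_itv/= ?andbT ?expR_ge0// ler_expR.
Qed.

(** Rapidity gives Phi w x >= (n + 1) x for large x, and the tangent at x lies
    below Phi w at 0; hence P1 x >= n + 1 - Phi w 0 / x. *)
Lemma rapid_slope_unbounded (R : realType) (w P1 : R -> R) :
  weight_function w -> rapid w -> log_convex w ->
  (forall x : R, is_derive x (1 : R) (Phi w) (P1 x)) ->
  forall k X : R, exists2 x, X <= x & k <= P1 x.
Proof.
move=> [w0 _ _ _] wr wc dP k X.
pose n := (Num.truncn k).+1.
have kn : k <= n%:R by apply/ltW; exact: truncnS_gt.
have /cvgryPge/(_ 1)[M [_ Mw]] := wr n.+1.
pose x := `|X| + `|M| + `|Phi w 0| + 1.
have absX := normr_ge0 X; have absM := normr_ge0 M.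
have absP := normr_ge0 (Phi w 0).
have lX := ler_norm X; have lM := ler_norm M; have lP := ler_norm (Phi w 0).
have x0 : 0 < x by rewrite /x; lra.
exists x; first by rewrite /x; lra.
have wx0 : 0 < w (expR x) by apply: w0; exact: expR_ge0.
have Px : n.+1%:R * x <= Phi w x.
  have : 1 <= expR x ^- n.+1 * w (expR x).
    apply: Mw; apply: lt_le_trans (expR_ge1Dx x); rewrite /x; lra.
  rewrite ler_pdivlMl ?exprn_gt0 ?expR_gt0// mulr1 => wx.
  rewrite -[n.+1%:R * x]expRK ler_ln ?posrE ?expR_gt0//.
  by rewrite expRM_natl.
have := convex_tangent_le 0 wc (dP x); rewrite sub0r mulrN => tx.
have Pxx : Phi w 0 <= x by rewrite /x; lra.
rewrite -natr1 in Px.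
apply: le_trans kn _; rewrite -(ler_pM2r x0); lra.
Qed.

Lemma Phi_close (R : realType) (w v : R -> R) :
  weight_function w -> weight_function v -> equivalent w v ->
  exists C, forall x, `|Phi v x - Phi w x| <= C.
Proof.
move=> [w0 _ _ _] [v0 _ _ _] [C1 [C2 [C10 C20 wv]]].
exists (`|ln C1| + `|ln C2|) => x.
have wx : 0 < w (expR x) by apply: w0; exact: expR_ge0.
have vx : 0 < v (expR x) by apply: v0; exact: expR_ge0.
have /andP[] := wv _ (expR_ge0 x).
rewrite -[C1 * _ <= _]ler_ln ?posrE ?mulr_gt0// -[v _ <= _]ler_ln ?posrE ?mulr_gt0//.
rewrite !lnM// /Phi.
have := ler_norm (ln C2); have := ler_norm (- ln C1); rewrite normrN.
have := normr_ge0 (ln C1); have := normr_ge0 (ln C2).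
by move=> *; rewrite ler_norml; apply/andP; split; lra.
Qed.

(** For t > e^B the monomial d t^j, obtained by lowering by 1/a the line of slope j
    through the point of abscissa ln t, is admissible and loses only the factor
    e^(1/a); for t <= e^B the constant monomial w 0 loses at most w (e^B) / w 0.
    The constant K is the sum of the two factors. *)
Lemma weight_le_power_minorant (R : realType) (w P1 P2 : R -> R) (a A : R) :
  weight_function w -> log_convex w ->
  (forall x : R, is_derive x (1 : R) (Phi w) (P1 x)) ->
  (forall x : R, is_derive x (1 : R) P1 (P2 x)) ->
  0 < a -> (forall y, A < y -> a <= P2 y) ->
  exists2 K, 0 < K & forall t, 0 <= t -> w t <= K * power_minorant w t.
Proof.
move=> ww wc dP dP1 a0 aP2; have [w0 wh _ _] := ww.
pose B := A + a^-1.
have wB : 0 < w (expR B) by apply: w0; exact: expR_ge0.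
have w00 : 0 < w 0 by exact: w0.
exists (expR a^-1 + w (expR B) / w 0) => [|t t0].
  by rewrite addr_gt0 ?expR_gt0 ?divr_gt0.
have vt : w 0 <= power_minorant w t.
  apply: power_minorant_ge_at0 => // s s0; apply: wh => //; rewrite in_itv/= andbT//.
have vt0 : 0 <= power_minorant w t by apply: le_trans vt; exact: ltW.
rewrite mulrDl; have [tB|Bt] := leP t (expR B).
  apply: (@le_trans _ _ (w (expR B))).
    by apply: wh => //; rewrite in_itv/= andbT// expR_ge0.
  apply: ler_wpDl; first by rewrite mulr_ge0 ?expR_ge0.
  by rewrite mulrAC ler_pdivlMr// ler_pM2l.
have tgt0 : 0 < t by apply: lt_trans Bt; exact: expR_gt0.
apply: ler_wpDr; first by rewrite mulr_ge0// divr_ge0// ltW.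
have BE : A + a^-1 < ln t by rewrite -ltr_expR lnK.
have [j j0 jP] := integral_slope_support wc dP dP1 (Phi_homo ww) a0 aP2 BE.
pose d := expR (Phi w (ln t) - j%:R * ln t - a^-1).
have powE s : 0 < s -> s ^+ j = expR (j%:R * ln s).
  by move=> s0; rewrite expRM_natl lnK.
have PhiE s : 0 < s -> expR (Phi w (ln s)) = w s.
  by move=> s0; rewrite /Phi lnK ?lnK ?posrE ?w0// ltW.
have dc : d <= power_coef w j.
  apply: le_power_coef => // [|s]; first exact: expR_ge0.
  rewrite le_eqVlt => /predU1P[<-|s0]; first by rewrite expr0n gtn_eqF// mulr0 ltW.
  rewrite powE// -[w s]PhiE// /d -expRD ler_expR.
  by have := jP (ln s); lra.
apply: (@le_trans _ _ (expR a^-1 * (d * t ^+ j))).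
  by rewrite powE// /d -!expRD -{1}[w t]PhiE// ler_expR; lra.
rewrite ler_pM2l ?expR_gt0//; apply: le_trans (power_minorant_ge w0 j t0).
by rewrite ler_wpM2r// exprn_ge0.
Qed.

(** * Equivalence with log-tropical weights *)

Theorem theorem3 (R : realType) (w : R -> R)
  (w_weight : weight_function w) (w_rapid : rapid w)
  (w_convex : log_convex w) (w_C2 : C2_on `[0, +oo[ w) :
  ((0 < limf_einf (fun x => ((Phi w)^`(2)%classic x)%:E) (pinfty_nbhs R))%E ->
     exists v : R -> R, log_tropical_weight v /\ equivalent w v) /\
  (limf_esup (fun x => ((Phi w)^`(2)%classic x)%:E) (pinfty_nbhs R) = 0%E ->
     ~ exists v : R -> R, log_tropical_weight v /\ equivalent w v).
Proof.
have dP x := (is_derive_Phi x w_weight w_C2).1.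
have dP1 x := (is_derive_Phi x w_weight w_C2).2.
split=> [/limf_einf_pinfty_gt0[a [A [a0 aP2]]]|limsup0 [v [[wv tv] wvE]]].
  have [K K0 wK] := weight_le_power_minorant w_weight w_convex dP dP1 a0 aP2.
  by exists (power_minorant w); exact: power_minorant_equivalent K0 wK.
have [C vC] := Phi_close w_weight wv wvE.
apply: (tropical_not_close w_convex dP dP1 _ _ tv vC).
  exact: rapid_slope_unbounded w_weight w_rapid w_convex dP.
move=> e e0; apply: limf_esup_pinfty_lt.
by rewrite (_ : limf_esup _ _ = 0%E)// lte_fin.
Qed.
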